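(* Let $k$ be an integer, and let $G$ be a graph of order $n$. (1) If $\delta(G)\geq k\geq 0$ and $\rho(G)\geq \rho(\underline{N}_n^k)$, where $n\geq \max\{6k+10,(k^2+7k+8)/2\}$, then $G$ is traceable unless $G=\underline{N}_n^k$. (2) If $\delta(G)\geq k\geq 1$ and $\rho(G)\geq \rho(N_n^k)$, where $n\geq\max\{6k+5,(k^2+6k+4)/2\}$, then $G$ is Hamiltonian unless $G=N_n^k$.
   Context: All graphs are finite and simple; equality of graphs means isomorphism. $\delta(G)$ is the minimum degree of $G$ and $\rho(G)$ is the spectral radius, i.e. the largest eigenvalue of the adjacency matrix. A graph is Hamiltonian (traceable) if it contains a cycle (path) through all its vertices. $G_1+G_2$ denotes the disjoint union of graphs, $kG$ the disjoint union of $k$ copies of $G$, and $G_1\vee G_2$ the join (the disjoint union together with all edges between $V(G_1)$ and $V(G_2)$). For $1\leq k\leq (n-1)/2$, $N_n^k=K_k\vee(K_{n-2k}+kK_1)$. For $0\leq k\leq n/2-1$, $\underline{N}_n^k=K_k\vee(K_{n-2k-1}+(k+1)K_1)$ (for $k=0$ this is $K_{n-1}+K_1$). *)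

(* Defs.v *)
From mathcomp Require Import all_boot all_order all_algebra.
From mathcomp Require Import classical_sets reals.
Set Implicit Arguments.
Unset Strict Implicit.
Unset Printing Implicit Defensive.
Import Order.TTheory GRing.Theory Num.Theory.
Local Open Scope ring_scope.

Record sgraph := SGraph {
  vertex :> finType;
  adj : rel vertex;
  adj_sym : symmetric adj;
  adj_irr : irreflexive adj
}.

Definition isomorphic (G H : sgraph) : Prop :=
  exists2 f : G -> H, bijective f & forall x y, adj (f x) (f y) = adj x y.

Section Constructions.

Definition complete_adj (n : nat) : rel 'I_n := fun x y => x != y.

Fact complete_sym n : symmetric (@complete_adj n).
Proof. by move=> x y; rewrite /complete_adj eq_sym. Qed.

Fact complete_irr n : irreflexive (@complete_adj n).
Proof. by move=> x; rewrite /complete_adj eqxx. Qed.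

Definition complete n : sgraph := SGraph (@complete_sym n) (@complete_irr n).

Variables G1 G2 : sgraph.

Definition union_adj : rel (G1 + G2)%type := fun u v =>
  match u, v with
  | inl x, inl y => adj x y
  | inr x, inr y => adj x y
  | _, _ => false
  end.

Fact union_sym : symmetric union_adj.
Proof. by move=> [x|x] [y|y] //=; apply: adj_sym. Qed.

Fact union_irr : irreflexive union_adj.
Proof. by move=> [x|x] /=; apply: adj_irr. Qed.

Definition union : sgraph := SGraph union_sym union_irr.

Definition join_adj : rel (G1 + G2)%type := fun u v =>
  match u, v with
  | inl x, inl y => adj x y
  | inr x, inr y => adj x y
  | _, _ => true
  end.

Fact join_sym : symmetric join_adj.
Proof. by move=> [x|x] [y|y] //=; apply: adj_sym. Qed.

Fact join_irr : irreflexive join_adj.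
Proof. by move=> [x|x] /=; apply: adj_irr. Qed.

Definition join : sgraph := SGraph join_sym join_irr.

Variables (k : nat) (G : sgraph).

Definition copies_adj : rel ('I_k * G)%type :=
  fun u v => (u.1 == v.1) && adj u.2 v.2.

Fact copies_sym : symmetric copies_adj.
Proof. by move=> u v; rewrite /copies_adj eq_sym adj_sym. Qed.

Fact copies_irr : irreflexive copies_adj.
Proof. by move=> u; rewrite /copies_adj adj_irr andbF. Qed.

Definition copies : sgraph := SGraph copies_sym copies_irr.

End Constructions.

(* The subtractions are truncated: these two families are meaningful for
   k <= (n - 1) / 2 and for k <= n / 2 - 1, respectively. *)
Definition graphN (n k : nat) : sgraph :=
  join (complete k) (union (complete (n - 2 * k)) (copies k (complete 1))).

Definition graphNu (n k : nat) : sgraph :=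
  join (complete k)
       (union (complete (n - 2 * k - 1)) (copies k.+1 (complete 1))).

Definition degree (G : sgraph) (x : G) : nat := #|[set y | adj x y]|.

(* Degrees are less than #|G|, so the default value only matters for the
   empty graph, whose minimum degree is set to 0. *)
Definition min_degree (G : sgraph) : nat :=
  \big[minn/#|G|]_(x : G) degree x.

Definition adjmx (R : realType) (G : sgraph) : 'M[R]_#|G| :=
  \matrix_(i, j) (adj (enum_val i) (enum_val j))%:R.

(* The set of eigenvalues is finite and, when G has a vertex, nonempty
   (adjmx R G is symmetric): the supremum is then the largest eigenvalue. *)
Definition spectral_radius (R : realType) (G : sgraph) : R :=
  sup [set a : R | eigenvalue (adjmx R G) a]%classic.

Definition traceable (G : sgraph) : Prop :=
  exists x : G, exists p : seq G,
    [/\ path (@adj G) x p, uniq (x :: p) & forall y : G, y \in x :: p].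

Definition hamiltonian (G : sgraph) : Prop :=
  exists c : seq G,
    [/\ ucycle (@adj G) c, (3 <= size c)%N & forall y : G, y \in c].

(* Main.v *)
(* Close [G] under adding an edge [uv] whenever [u] and [v] are not adjacent and
   $d(u) + d(v) \ge n - s$ ([s = 0] for Hamiltonicity, by Ore; [s = 1] for
   traceability, by applying Ore to the cone over the graph). If [G] lacks the
   property, so does the closure [H], and $\rho(H) \ge \rho(G)$.
   Comparing $A^2 - (k-1)A$ with its row sums on a Perron vector gives
   $\rho(H)^2 - (k-1)\rho(H) \le 2e(H) - k(n-1)$, so $\rho(H) \ge n-k-s-1$
   (strictly for [k > 0]) makes [H] dense, and an Erdos-type count then shows
   that the vertices of degree [k] form a set [T] of size [k + s] while all
   others form a clique, of which a subset [F] is completely joined to [T] and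
   the rest is not joined to [T].
   If [F] has fewer than [k] vertices, deleting the edges inside [T] and joining
   [T] to further clique vertices strictly increases the spectral radius and
   yields the extremal graph: a contradiction. Hence [H] is extremal, and
   $\rho(G) \ge \rho(H)$ for the spanning subgraph [G] of [H] forces [G = H]. *)

Require Import Defs.
From mathcomp Require Import all_boot all_order all_algebra.
From mathcomp Require Import boolp classical_sets reals.
From mathcomp Require Import topology normedtype derive.
(* [classical_sets] shadows lemmas of [finset] such as [subsetP]. *)
From mathcomp Require Import fintype finset ring lra zify.
Import Order.TTheory GRing.Theory Num.Theory.
Import numFieldNormedType.Exports.
Set Implicit Arguments.
Unset Strict Implicit.
Unset Printing Implicit Defensive.

(** * Ore's theorem and the closure *)

Section Ore.
Variable V : finType.
Implicit Type e : rel V.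

Definition deg e x := #|[set y | e x y]|.

Definition ham_rel e := exists c : seq V,
  [/\ ucycle e c, 3 <= size c & forall y, y \in c].

Definition trace_rel e := exists x : V, exists p : seq V,
  [/\ path e x p, uniq (x :: p) & forall y, y \in x :: p].

Definition add_edge e u v : rel V :=
  fun x y => [|| e x y, (x == u) && (y == v) | (x == v) && (y == u)].

Lemma add_edge_sym e u v : symmetric e -> symmetric (add_edge e u v).
Proof.
move=> es x y; rewrite /add_edge es; congr (_ || _).
by rewrite orbC ![_ && (y == _)]andbC.
Qed.

Lemma add_edge_irr e u v : u != v -> irreflexive e -> irreflexive (add_edge e u v).
Proof.
move=> uv ei x; rewrite /add_edge ei /=.
by have [->|] //= := eqVneq x u; rewrite ?(negPf uv) ?andbF.
Qed.

Lemma eq_ham_rel e e' : e =2 e' -> ham_rel e -> ham_rel e'.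
Proof.
move=> ee [c [/andP[cc cu] c3 cm]]; exists c; split => //.
by rewrite /ucycle -(eq_cycle ee) cc.
Qed.

(** Pigeonhole on two lists read in parallel: the total count exceeds the number of positions, so
    both predicates hold at a common position. *)
Lemma count_overlap (a b : pred V) (p q : seq V) : size p = size q ->
    size p < count a p + count b q ->
  exists p1 x p2 q1 y q2,
    [/\ p = p1 ++ x :: p2, q = q1 ++ y :: q2, size p1 = size q1, a x & b y].
Proof.
elim: p q => [|x p IH] [|y q] //= [spq].
have [/andP[ax by_] _|nab ab] := boolP (a x && b y).
  by exists [::], x, p, [::], y, q.
have [|p1 [x' [p2 [q1 [y' [q2 [-> -> s12 ax by_]]]]]]] := IH q spq.
  by move: nab ab; case: (a x); case: (b y); lia.
by exists (x :: p1), x', p2, (y :: q1), y', q2; split=> //=; rewrite s12.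
Qed.

Lemma card_full (s : seq V) : uniq s -> (forall y, y \in s) -> #|V| = size s.
Proof. by move=> /card_uniqP <- sm; apply: eq_card => y; rewrite sm. Qed.

Lemma deg_count e x s : uniq s -> (forall y, y \in s) -> deg e x = count (e x) s.
Proof.
move=> su sm; rewrite /deg cardsE -size_filter; apply/esym.
rewrite -(card_uniqP (filter_uniq _ su)); apply: eq_card => y.
by rewrite mem_filter sm andbT.
Qed.

(** The pigeonhole gives consecutive vertices [y], [x] of the path such that the start [u] is
    adjacent to [x] and the end is adjacent to [y]. Follow the path from [u] to [y], jump to the
    end, walk back to [x] and close up at [u]. *)
Lemma ham_path_ore e u p : symmetric e -> irreflexive e ->
    path e u p -> uniq (u :: p) -> (forall y, y \in u :: p) ->
    3 <= #|V| <= deg e u + deg e (last u p) ->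
  ham_rel e.
Proof.
move=> es ei ep pu pm /andP[V3].
have szV : #|V| = (size p).+1 by rewrite (card_full pu).
rewrite !(deg_count _ _ pu pm) {2}lastI -cats1 count_cat /= !ei addn0 add0n addn0 szV.
move=> /(count_overlap (esym (size_belast u p))).
move=> [p1 [x [p2 [q1 [y [q2 [pE qE s12 ux vy]]]]]]].
move: qE; rewrite pE belast_cat /= => /eqP; rewrite eqseq_cat ?size_belast //.
move=> /andP[_ /eqP[yE _]].
have rE : rev (x :: p2) = last u p :: rev (belast x p2).
  by rewrite lastI rev_rcons pE last_cat.
exists (u :: p1 ++ rev (x :: p2)); split; last 2 first.
- by rewrite /= size_cat size_rev -size_cat -pE -szV.
- by move=> z; rewrite -cat_cons mem_cat mem_rev -mem_cat cat_cons -pE.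
apply/andP; split; last first.
  rewrite -cat_cons (@perm_uniq _ _ (u :: p)) // pE -cat_cons perm_cat2l.
  by rewrite perm_rev.
move: ep; rewrite pE cat_path => /andP[ep1 /= /andP[_ ep2]].
rewrite rcons_cat cat_path ep1 /= rE /= yE es vy /=.
rewrite rcons_path; apply/andP; split.
  rewrite pE last_cat /= rev_path; apply: sub_path ep2 => a b; by rewrite es.
rewrite -[last _ _]/(last y (last u p :: rev (belast x p2))) -rE rev_cons.
by rewrite last_rcons es.
Qed.

(* A path starting at u meets the pair uv only in its first step. *)
Lemma path_add_edge e u v h q : path (add_edge e u v) u (h :: q) ->
  u \notin h :: q -> h != v -> path e u (h :: q).
Proof.
move=> /= /andP[uh hq] uq hv.
have uv : u != h by move: uq; rewrite inE negb_or => /andP[].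
apply/andP; split.
  move: uh; rewrite /add_edge (negPf hv) !andbF /= [h == u]eq_sym (negPf uv).
  by rewrite andbF !orbF.
apply: (@sub_in_path _ (mem (h :: q)) _ _ _ _ _ _ hq) => [a b /= ain bin|].
  rewrite /add_edge; have /negPf -> : a != u by apply: contraNneq uq => <-.
  by have /negPf -> : b != u by [apply: contraNneq uq => <-]; rewrite andbF /= !orbF.
by apply/allP.
Qed.

Lemma ore_ham_half e u v p : symmetric e -> irreflexive e -> u != v ->
    path (add_edge e u v) u p -> uniq (u :: p) -> (forall y, y \in u :: p) ->
    last u p = v -> 3 <= #|V| <= deg e u + deg e v ->
  ham_rel e.
Proof.
move=> es ei uv ep pu pm pv Vn.
apply: (@ham_path_ore e u p) => //; last by rewrite pv.
have szV : #|V| = (size p).+1 by rewrite (card_full pu).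
case: p => [//|h [|h' q]] in ep pu pm pv szV *; first by rewrite szV in Vn.
apply: path_add_edge ep _ _; first by case/andP: pu.
rewrite -pv; apply/negP => /eqP hE; move: pu => /= /and3P[_ /negP[]].
by rewrite {1}hE /= mem_last.
Qed.

Lemma add_edgeC e u v : add_edge e u v =2 add_edge e v u.
Proof. by move=> x y; rewrite /add_edge [(x == v) && _ || _]orbC. Qed.

(** Rotate the cycle so that it starts at [u]. The new edge can then only be its closing or its
    first step; removing it leaves a Hamiltonian path of [e] between [u] and [v]. Otherwise the
    cycle already lies in [e]. *)
Lemma ore_ham e u v : symmetric e -> irreflexive e -> u != v ->
  3 <= #|V| <= deg e u + deg e v -> ham_rel (add_edge e u v) -> ham_rel e.
Proof.
move=> es ei uv Vn [c [/andP[cc cu] c3 cm]].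
have [i p cE] := rot_to (cm u).
move: cc cu; rewrite -(rot_cycle i) -(rot_uniq i) cE => cc cu.
have pm y : y \in u :: p by rewrite -cE mem_rot.
have /= ps : size (u :: p) = size c by rewrite -cE size_rot.
have [pv|pv] := eqVneq (last u p) v.
  apply: (ore_ham_half es ei uv _ cu pm pv Vn).
  by move: cc => /=; rewrite rcons_path => /andP[].
case: p => [|h q] in cE cc cu pm ps pv *; first by move: c3; rewrite -ps.
(* Here the new edge is the first step: reading the cycle from [v] on gives a path ending at [u], so
   the half lemma applies with [u] and [v] exchanged. *)
have [hv|hv] := eqVneq h v.
  rewrite hv in cE cc cu pm ps pv *.
  apply: (@ore_ham_half e v u (rcons q u)) => //; rewrite ?last_rcons 1?eq_sym //.
  - by rewrite -(eq_path (add_edgeC e u v)); case/andP: cc.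
  - by rewrite -rcons_cons rcons_uniq.
  - by move=> y; rewrite -rcons_cons mem_rcons pm.
  - by rewrite addnC.
exists (u :: h :: q); split => //; last by rewrite /= ps.
apply/andP; split => //.
have /andP[cp cl] : path (add_edge e u v) u (h :: q) &&
    add_edge e u v (last u (h :: q)) u by rewrite -rcons_path.
rewrite /cycle rcons_path (path_add_edge cp) //=; last by case/andP: cu.
move: cl; rewrite /add_edge (negPf pv) (negPf uv) andbF !orbF.
by [].
Qed.

Definition cone_rel e : rel (option V) := fun x y =>
  match x, y with
  | Some x, Some y => e x y
  | None, None => false
  | _, _ => true
  end.

Lemma deg_cone_rel e x : #|[set y | cone_rel e (Some x) y]| = (deg e x).+1.
Proof.
rewrite (cardsD1 None) inE /= add1n; congr _.+1.
rewrite /deg -(card_imset _ (@Some_inj _)); apply: eq_card => -[y|].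
  by rewrite !inE mem_imset ?inE //; apply: Some_inj.
by rewrite !inE; apply/esym/negbTE/imsetP => -[].
Qed.

Lemma trace_ham_cone e : 2 <= #|V| -> trace_rel e ->
  exists c : seq (option V),
    [/\ ucycle (cone_rel e) c, 3 <= size c & forall y, y \in c].
Proof.
move=> V2 [x [p [xp up pm]]]; exists (None :: map some (x :: p)); split.
- apply/andP; split; last first.
    rewrite cons_uniq map_inj_uniq ?up ?andbT; last exact: Some_inj.
    by apply/mapP => -[].
  rewrite /cycle rcons_path; apply/andP; split; last by rewrite /= last_map.
  by rewrite /= path_map.
- by move: V2; rewrite (card_full up pm) /= size_map.
- by case=> [y|//]; rewrite in_cons map_f ?orbT.
Qed.

Lemma ham_cone_trace e (c : seq (option V)) : ucycle (cone_rel e) c -> 3 <= size c ->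
  (forall y, y \in c) -> trace_rel e.
Proof.
move=> /andP[cc cu] c3 cm; have [i q cE] := rot_to (cm None).
move: cc cu; rewrite -(rot_cycle i) -(rot_uniq i) cE => cc cu.
have qm y : Some y \in q by have := cm (Some y); rewrite -(mem_rot i) cE.
have qE : q = map some (pmap id q).
  have: None \notin q by case/andP: cu.
  elim: (q) => [|[y|] r IH] //=.
  by rewrite in_cons => /IH {1}->.
move: cc cu qm; rewrite qE; case: (pmap id q) => [|x p] cc cu qm.
  by move: c3; rewrite -(size_rot i) cE qE.
exists x, p; split; first by move: cc; rewrite /= rcons_path path_map => /andP[].
  by move: cu; rewrite cons_uniq (map_inj_uniq (@Some_inj _)) => /andP[].
by move=> y; have := qm y; rewrite mem_map //; apply: Some_inj.
Qed.

End Ore.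

Lemma cone_rel_sym (V : finType) (e : rel V) : symmetric e -> symmetric (cone_rel e).
Proof. by move=> es [x|] [y|] //=. Qed.

Lemma cone_rel_irr (V : finType) (e : rel V) : irreflexive e -> irreflexive (cone_rel e).
Proof. by move=> ei [x|] //=. Qed.

(** In the cone the order and both degrees grow by one, so the degree condition weakened by one is
    exactly Ore's condition there. *)
Lemma ore_trace (V : finType) (e : rel V) u v : symmetric e -> irreflexive e -> u != v ->
  2 <= #|V| <= (deg e u + deg e v).+1 -> trace_rel (add_edge e u v) -> trace_rel e.
Proof.
move=> es ei uv /andP[V2 Vd] /(trace_ham_cone V2) H.
have := @ore_ham _ (cone_rel e) (Some u) (Some v) (cone_rel_sym es) (cone_rel_irr ei) uv.
rewrite card_option /deg !deg_cone_rel -/(deg e u) -/(deg e v) addSn addnS !ltnS V2 Vd.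
case=> // [|c [cc c3 cm]]; last exact: ham_cone_trace cc c3 cm.
by apply: eq_ham_rel H => -[x|] [y|] //=; rewrite /add_edge /= orbF.
Qed.

(* The Bondy-Chvatal closure, stated for a property [P] of the graphs on [V]. *)
Lemma closure_exists (V : finType) (P : rel V -> Prop) (s : nat) :
    (forall e u v, symmetric e -> irreflexive e -> u != v ->
      #|V| <= deg e u + deg e v + s -> P (add_edge e u v) -> P e) ->
  forall e, symmetric e -> irreflexive e -> ~ P e ->
  exists e', [/\ symmetric e', irreflexive e', subrel e e', ~ P e' &
    forall u v, u != v -> ~~ e' u v -> deg e' u + deg e' v + s < #|V|].
Proof.
move=> ore e; have [m] := ubnP #|[set p | ~~ e p.1 p.2]|.
elim: m e => // m IH e em es ei nP.
have [/existsP[u /existsP[v /and3P[uv euv big]]]|] :=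
  boolP [exists u, exists v, [&& u != v, ~~ e u v & #|V| <= deg e u + deg e v + s]].
  have [||||e' [es' ei' sub nP' cl]] := IH (add_edge e u v).
  - apply: (@leq_trans #|[set p | ~~ e p.1 p.2]|); last by rewrite -ltnS.
    apply: proper_card; apply/properP; split.
      by apply/subsetP => p; rewrite !inE /add_edge; apply: contra => ->.
    by exists (u, v); rewrite !inE //= /add_edge !eqxx orbT.
  - exact: add_edge_sym.
  - exact: add_edge_irr.
  - by move=> /(ore _ _ _ es ei uv big).
  exists e'; split => // x y exy; apply: sub; by rewrite /add_edge exy.
rewrite negb_exists => /forallP ncl; exists e; split => // u v uv euv.
have := ncl u; rewrite negb_exists => /forallP /(_ v).
by rewrite uv euv /= -ltnNge.
Qed.

(** * Dense closed graphs *)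

Section Degrees.
Variables (V : finType) (e : rel V).
Hypotheses (es : symmetric e) (ei : irreflexive e).
Implicit Types (S : {set V}) (h p k s : nat).
Let n := #|V|.

Definition low_deg h := [set x | deg e x <= h].

Record split_at k s (F T : {set V}) : Prop := SplitAt {
  split_disj : [disjoint F & T];
  split_card : #|T| = k + s;
  split_clique : forall x y, x \notin T -> y \notin T -> x != y -> e x y;
  split_full : forall x t, x \in F -> t \in T -> e x t;
  split_none : forall x t, x \notin F -> x \notin T -> t \in T -> ~~ e x t;
  split_deg : forall t, t \in T -> deg e t = k
}.

Lemma deg_le_subset x S : (forall y, y \in S -> y != x -> e x y) -> #|S :\ x| <= deg e x.
Proof.
move=> h; apply: subset_leq_card; apply/subsetP => y; rewrite !inE => /andP[yx yS].
exact: h.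
Qed.

Lemma sum_deg_cross S :
  \sum_(x in ~: S) #|[set y in S | e x y]| = \sum_(y in S) #|[set x in ~: S | e y x]|.
Proof.
have E A x : #|[set y in A | e x y]| = \sum_(y in A) e x y.
  by rewrite -sum1dep_card big_mkcondr.
under eq_bigr do rewrite E; rewrite exchange_big; apply: eq_bigr => y _.
by rewrite E; apply: eq_bigr => x _; rewrite es.
Qed.

(** At most [h * #|S|] edges meet [S], each counted at most twice; the remaining edges lie in a
    complete graph on the complement. *)
Lemma sum_deg_le S h : (forall x, x \in S -> deg e x <= h) ->
  \sum_x deg e x <= 2 * h * #|S| + (n - #|S|) * (n - #|S| - 1).
Proof.
move=> hS; rewrite (bigID (mem S)) /=.
have hsum : \sum_(x in S) deg e x <= h * #|S|.
  by rewrite mulnC -sum_nat_const; apply: leq_sum => x /hS.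
have cS : #|~: S| = n - #|S| by rewrite cardsCs setCK.
have -> : \sum_(x | x \notin S) deg e x =
    \sum_(x in ~: S) (#|[set y in S | e x y]| + #|[set y in ~: S | e x y]|).
  rewrite (eq_bigl (fun x => x \in ~: S)); last by move=> x; rewrite inE.
  apply: eq_bigr => x _; rewrite /deg -(cardsID S [set y | e x y]).
  by congr addn; apply: eq_card => y; rewrite !inE // andbC.
rewrite big_split /= sum_deg_cross.
have : \sum_(y in S) #|[set x in ~: S | e y x]| <= h * #|S|.
  apply: leq_trans hsum; apply: leq_sum => x _; apply: subset_leq_card.
  by apply/subsetP => y; rewrite !inE => /andP[].
have : \sum_(x in ~: S) #|[set y in ~: S | e x y]| <= (n - #|S|) * (n - #|S| - 1).
  rewrite -cS -sum_nat_const; apply: leq_sum => x xS.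
  rewrite (cardsD1 x (~: S)) xS add1n subn1 /=; apply: subset_leq_card.
  apply/subsetP => y; rewrite !inE => /andP[-> exy]; rewrite andbT.
  by apply: contraTneq exy => ->; rewrite ei.
lia.
Qed.

Lemma sum_deg_low h p : p <= #|low_deg h| ->
  \sum_x deg e x <= 2 * h * p + (n - p) * (n - p - 1).
Proof.
move=> /card_geqP[S [uS <- sub]].
have := @sum_deg_le [set x in S] h; rewrite cardsE (card_uniqP uS); apply => x.
by rewrite inE => /sub; rewrite inE.
Qed.

Variables k s : nat.
Hypotheses (n_big : 6 * k + 5 * s + 5 <= n) (deg_min : forall x, k <= deg e x).
Hypothesis (deg_closed : forall u v, u != v -> ~~ e u v -> deg e u + deg e v + s < n).
Hypothesis (dense :
  2 * k.+1 * (k.+1 + s) + (n - k - s - 1) * (n - k - s - 2) < \sum_x deg e x).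

(* As a function of [h], the right-hand side of [sum_deg_low] with [p = h + s]
   is convex, and [n_big] makes it maximal at [h = k + 1] on the range
   [k + 1 <= h <= (n - 1 - s) / 2]. *)
Lemma high_deg_adj x y : x != y -> k < deg e x -> k < deg e y -> e x y.
Proof.
(* Among the counterexamples take a pair with the largest degree sum, the smaller degree [h] being
   that of [u]. *)
pose P (z : V * V) := [&& z.1 != z.2, ~~ e z.1 z.2, k < deg e z.1 & k < deg e z.2].
move=> xy kx ky; apply/negPn/negP => exy.
have P0 : P (x, y) by rewrite /P /= xy exy kx ky.
case: (@arg_maxnP _ (x, y) P (fun z => deg e z.1 + deg e z.2) P0) => -[u v] /=.
wlog uv : u v / deg e u <= deg e v => [wl|].
  have [/wl//|/ltnW vu] := leqP (deg e u) (deg e v).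
  move=> Puv mx; apply: (wl v u) => //.
    by move: Puv; rewrite /P /= eq_sym es => /and4P[-> -> -> ->].
  by move=> z /mx /=; rewrite [X in _ -> _ <= X]addnC.
move=> /and4P[/= nuv neuv ku kv] mx.
set h := deg e u in uv ku mx.
have hv := deg_closed nuv neuv.
(* Every non-neighbour [w] of [v] has degree at most [h], since otherwise the pair [(w, v)] would
   have a larger sum. By closedness there are at least [n - 1 - deg e v >= h + s] such vertices. *)
have low : h + s <= #|low_deg h|.
  apply: (@leq_trans #|[set w | w != v] :\: [set w | e v w]|); last first.
    apply: subset_leq_card; apply/subsetP => w; rewrite !inE => /andP[vw wv].
    have [wk|wk] := leqP (deg e w) k; first by apply: leq_trans wk (ltnW ku).
    have := mx (w, v); rewrite /P /= wv es vw wk kv leq_add2r; exact.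
  have := cardsID [set w | e v w] [set w | w != v].
  have -> : #|[set w | w != v]| = n - 1.
    by rewrite subn1 -(cardsC1 v); apply: eq_card => w; rewrite !inE.
  have : #|[set w | w != v] :&: [set w | e v w]| <= deg e v.
    by apply: subset_leq_card; apply: subsetIr.
  move: hv; rewrite -/h; lia.
have := sum_deg_low low; apply/negP; rewrite -ltnNge; apply: leq_trans dense.
(* In terms of the slacks [t] and [r], the bound in [dense] minus the one just obtained equals $t(2r
   + t - (2k + 2s + 1))$, which [rt] makes nonnegative. *)
have [t hE] : exists t, h = k + 1 + t by exists (h - k.+1); lia.
have [r nE] : exists r, n = 2 * h + 1 + s + r by exists (n - (2 * h + 1 + s)); lia.
have rt : 2 * k + 2 * s + 1 <= 2 * r + t by lia.
have -> : n - (h + s) = h + 1 + r by lia.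
have -> : n - k - s - 1 = h + 1 + r + t by lia.
have -> : n - k - s - 2 = h + r + t by lia.
have := leq_mul (leqnn t) rt; rewrite addn1 subn1 hE /=; clear; lia.
Qed.

(** [T] consists of the vertices of minimum degree [k]; the others form a clique by [high_deg_adj].
    Density bounds [#|T|] from above, closedness bounds it from below and shows that one neighbour
    in [T] forces adjacency to all of [T]. *)
Lemma closed_dense_split : (exists x y, x != y /\ ~~ e x y) ->
  exists F T : {set V}, split_at k s F T.
Proof.
move=> [x0 [y0 [xy0 exy0]]].
pose T := low_deg k.
have TP t : (t \in T) = (deg e t == k).
  by rewrite inE eqn_leq deg_min andbT.
have NT t : (t \notin T) = (k < deg e t) by rewrite inE ltnNge.
have clq x y : x \notin T -> y \notin T -> x != y -> e x y.
  by rewrite !NT => kx ky xy; apply: high_deg_adj.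
have cT : #|~: T| = n - #|T| by rewrite cardsCs setCK.
have degC x : x \notin T -> n - #|T| <= (deg e x).+1.
  move=> xT; have := @deg_le_subset x (~: T) _.
  move: cT; rewrite (cardsD1 x (~: T)) in_setC xT => <- h; rewrite add1n ltnS; apply: h => y.
  by rewrite in_setC => yT yx; apply: clq; rewrite // eq_sym.
have Tle : #|T| <= k + s.
  rewrite leqNgt; apply/negP => /sum_deg_low; rewrite leqNgt => /negP; apply.
  apply: leq_ltn_trans dense.
  have -> : n - (k + s).+1 = n - k - s - 1 by lia.
  have -> : n - k - s - 1 - 1 = n - k - s - 2 by lia.
  by rewrite leq_add2r; nia.
have [t tT] : exists t, t \in T.
  have [|xT] := boolP (x0 \in T); first by exists x0.
  have [|yT] := boolP (y0 \in T); first by exists y0.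
  by move: exy0; rewrite clq.
(* The [k] neighbours of [t] are too few to cover the complement of [T]. *)
have [x xT ext] : exists2 x, x \notin T & ~~ e x t.
  have : #|[set y | e t y]| < #|~: T|.
    rewrite cT.
    by have := TP t; rewrite tT => /esym/eqP; rewrite /deg => ->; lia.
  case: (boolP [exists x, (x \notin T) && ~~ e x t]) => [/existsP[x /andP[]]|].
    by exists x.
  rewrite negb_exists => /forallP nex; rewrite ltnNge => /negP[].
  apply: subset_leq_card; apply/subsetP => x; rewrite in_setC => xT.
  by have := nex x; rewrite xT negbK inE es.
have Tge : k + s <= #|T|.
  have xt : x != t by apply: contraNneq xT => ->.
  have := deg_closed xt ext; have := degC x xT; have := TP t.
  rewrite tT => /esym/eqP ->; lia.
pose F := [set x in ~: T | [exists t in T, e x t]].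
have FC z t2 : z \in F -> t2 \in T -> e z t2.
  rewrite inE inE => /andP[zT /exists_inP[t1 t1T ezt1]] t2T.
  apply/negPn/negP => ezt2.
  have zt2 : z != t2 by apply: contraNneq zT => ->.
  have := deg_closed zt2 ezt2; have := TP t2; rewrite t2T => /esym/eqP ->.
  (* Besides the rest of the clique, [z] has the neighbour [t1]; this extra unit of degree
     contradicts closedness for the pair [z], [t2]. *)
  suff : n - #|T| <= deg e z by lia.
  have -> : n - #|T| = #|(t1 |: ~: T) :\ z|.
    have := cardsD1 z (t1 |: ~: T).
    rewrite cardsU1 in_setC t1T /= cT in_setU1 [z \in ~: T]in_setC zT orbT.
    by move/eqP; rewrite eqSS => /eqP.
  apply: deg_le_subset => y; rewrite in_setU1 in_setC => /orP[/eqP -> //|yT] yz.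
  by apply: clq; rewrite // eq_sym.
exists F, T; split => //.
- by rewrite disjoints_subset; apply/subsetP => z; rewrite inE => /andP[].
- by apply/eqP; rewrite eqn_leq Tle.
- move=> z t' zF zT t'T; apply: contraNN zF => ezt; rewrite inE inE zT.
  by apply/exists_inP; exists t'.
- by move=> t'; rewrite TP => /eqP.
Qed.

End Degrees.

Local Open Scope ring_scope.

(** * Perron vectors and the Rayleigh quotient *)

Section Quadratic.
Context {R : realType} {G : sgraph}.
Implicit Types f g : G -> R.

Definition adjop f (v : G) : R := \sum_(w | adj v w) f w.
Definition dotf f g : R := \sum_v f v * g v.

Lemma dotfC f g : dotf f g = dotf g f.
Proof. by apply: eq_bigr => v _; rewrite mulrC. Qed.

Lemma adjop_sym f g : dotf f (adjop g) = dotf (adjop f) g.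
Proof.
rewrite /dotf /adjop; under eq_bigr do rewrite mulr_sumr.
rewrite (exchange_big_dep xpredT) //=; apply: eq_bigr => w _.
rewrite mulr_suml; apply: eq_bigl => v; exact: adj_sym.
Qed.

Lemma dotfDr f g h : dotf f (g \+ h) = dotf f g + dotf f h.
Proof. by rewrite /dotf -big_split; apply: eq_bigr => v _ /=; rewrite mulrDr. Qed.

Lemma dotfZr a f g : dotf f (fun v => a * g v) = a * dotf f g.
Proof. by rewrite /dotf mulr_sumr; apply: eq_bigr => v _; ring. Qed.

Lemma dotf_ge0 f : 0 <= dotf f f.
Proof. by apply: sumr_ge0 => v _; rewrite -expr2 sqr_ge0. Qed.

Lemma dotf_eq0 f : dotf f f = 0 -> forall v, f v = 0.
Proof.
move=> /eqP; rewrite psumr_eq0; last by move=> v _; rewrite -expr2 sqr_ge0.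
move=> /allP f0 v; have := f0 v (mem_index_enum _).
by rewrite /= mulf_eq0 orbb => /eqP.
Qed.

Lemma eq_dotf f f' g g' : f =1 f' -> g =1 g' -> dotf f g = dotf f' g'.
Proof. by move=> ff gg; apply: eq_bigr => v _; rewrite ff gg. Qed.

Lemma eq_adjop f f' : f =1 f' -> adjop f =1 adjop f'.
Proof. by move=> ff v; apply: eq_bigr => w _; rewrite ff. Qed.

(** A continuous function on the compact unit sphere attains its maximum. The topology lives on row
    vectors, and [F] reads them as functions on [G]. *)
Lemma quad_sphere_max : (0 < #|G|)%N ->
  exists2 f, dotf f f = 1 &
    forall g, dotf g g = 1 -> dotf g (adjop g) <= dotf f (adjop f).
Proof.
move=> G0.
pose F (x : 'rV[R]_#|G|) (v : G) : R := x 0 (enum_rank v).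
have Fc v : continuous (F^~ v) by apply: coord_continuous.
have sumc (P : pred G) (h : G -> 'rV[R]_#|G| -> R) :
    (forall v, continuous (h v)) -> continuous (fun x => \sum_(v | P v) h v x).
  by move=> hc; apply: continuous_big => //; apply: add_continuous.
have Mc (h h' : 'rV[R]_#|G| -> R) :
    continuous h -> continuous h' -> continuous (fun x => h x * h' x).
  by move=> hc hc' x; apply: continuousM; [exact: hc|exact: hc'].
have Nc : continuous (fun x => dotf (F x) (F x)).
  by apply: sumc => v; apply: Mc.
have Qc : continuous (fun x => dotf (F x) (adjop (F x))).
  apply: (sumc predT (fun v x => F x v * _)) => v; apply: Mc => //.
  exact: (sumc (adj v) (fun w x => F x w) Fc).
have [v0 _] : exists v : G, v \in G by apply/card_gt0P.
pose S : set 'rV[R]_#|G| := [set x | dotf (F x) (F x) = 1]%classic.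
have FE f : F (\row_i f (enum_val i)) =1 f.
  by move=> v; rewrite /F mxE enum_rankK.
have S0 : (S !=set0)%classic.
  exists (\row_i (enum_val i == v0)%:R); rewrite /S /=.
  rewrite (eq_dotf (FE (fun v => (v == v0)%:R)) (FE (fun v => (v == v0)%:R))).
  rewrite /dotf (bigD1 v0) //= eqxx mulr1 big1 ?addr0 // => v /negPf ->.
  by rewrite mulr0.
have Scl : closed S.
  by apply: (@preimage_closed _ _ (fun x => dotf (F x) (F x)) [set x | x = 1]%classic) => //.
have Sb : bounded_set S.
  exists 1; split => // M M1 x; rewrite /S /= => x1.
  suff : mx_norm x <= M by [].
  (* [mx_norm] is the maximum norm, attained at one entry, whose square is a single term of a sum
     equal to 1. *)
  have [->|/mx_norm_neq0[[i j] /= ->]] := eqVneq (mx_norm x) 0; first lra.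
  apply: le_trans (ltW M1); rewrite -(@expr_le1 _ 2) // real_normK ?num_real //.
  rewrite -x1 /dotf (bigD1 (enum_val j)) //= {1 2}/F enum_valK.
  rewrite (ord1 i) -expr2 lerDl; apply: sumr_ge0 => v _.
  by rewrite -expr2 sqr_ge0.
have [|x xS xmax] := EVT_max_rV S0 (bounded_closed_compact Sb Scl)
  (f := fun x => dotf (F x) (adjop (F x))).
  exact: continuous_subspaceT.
exists (F x); first by move/set_mem: xS.
move=> g g1; have := xmax (\row_i g (enum_val i)).
rewrite (eq_dotf (FE g) (eq_adjop (FE g))); apply; apply/mem_set.
by rewrite /S /= (eq_dotf (FE g) (FE g)).
Qed.

(** First-order condition at a minimum. With [D] positive and above [d], the value at [- c / D] is
    $(c/D)^2(d - D)$, negative unless [c] vanishes. *)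
Lemma linear_coef0 (c d : R) : (forall t, 0 <= c * t + d * t ^+ 2) -> c = 0.
Proof.
move=> h; pose D := `|d| + 1.
have Dp : 0 < D by rewrite /D; have := normr_ge0 d; lra.
have dD : d - D < 0 by rewrite /D; have := ler_norm d; lra.
have := h (- c / D).
have -> : c * (- c / D) + d * (- c / D) ^+ 2 = (c / D) ^+ 2 * (d - D).
  by field; rewrite gt_eqF.
rewrite nmulr_lge0 // => c0; apply/eqP; have : (c / D) ^+ 2 == 0.
  by rewrite eq_le c0 sqr_ge0.
by rewrite sqrf_eq0 mulf_eq0 invr_eq0 (gt_eqF Dp) orbF.
Qed.

Lemma quad_line f g t :
  dotf (fun v => f v + t * g v) (fun v => f v + t * g v) =
  dotf f f + t * dotf g f *+ 2 + t ^+ 2 * dotf g g.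
Proof.
rewrite /dotf !mulr_sumr -sumrMnl -!big_split; apply: eq_bigr => v _ /=; ring.
Qed.

Lemma quad_adjop_line f g t :
  dotf (fun v => f v + t * g v) (adjop (fun v => f v + t * g v)) =
  dotf f (adjop f) + t * dotf g (adjop f) *+ 2 + t ^+ 2 * dotf g (adjop g).
Proof.
have -> : dotf (fun v => f v + t * g v) (adjop (fun v => f v + t * g v)) =
    dotf f (adjop f) + t * dotf f (adjop g) + t * dotf g (adjop f)
    + t ^+ 2 * dotf g (adjop g).
  rewrite /dotf !mulr_sumr -!big_split; apply: eq_bigr => v _ /=.
  by rewrite /adjop big_split -mulr_sumr /=; ring.
by rewrite (adjop_sym f g) (dotfC _ g); ring.
Qed.

(** Perturb [f] along the residual [g] $= \mu f - Af$: the gap $\mu\langle h,h\rangle - \langle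
    h,Ah\rangle$ at $h = f + tg$ is nonnegative and has linear coefficient $2\langle g,g\rangle$. *)
Lemma quad_max_eigen f mu : dotf f (adjop f) = mu * dotf f f ->
    (forall g, dotf g (adjop g) <= mu * dotf g g) ->
  forall v, adjop f v = mu * f v.
Proof.
move=> fE fmax.
pose g v := mu * f v - adjop f v.
suff : dotf g g = 0 by move=> /dotf_eq0 g0 v; have := g0 v; rewrite /g; lra.
have gE : dotf g g = mu * dotf g f - dotf g (adjop f).
  rewrite -dotfZr -mulN1r -dotfZr -dotfDr; apply: eq_dotf => // v.
  by rewrite /g /=; ring.
suff : dotf g g *+ 2 = 0 by move=> /eqP; rewrite mulrn_eq0 => /eqP.
apply: (@linear_coef0 _ (mu * dotf g g - dotf g (adjop g))) => t.
have := fmax (fun v => f v + t * g v).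
rewrite quad_adjop_line quad_line fE -subr_ge0.
by rewrite [X in _ -> 0 <= X *+ 2 * _ + _]gE; congr (0 <= _); ring.
Qed.

Lemma quad_eq0 f : (forall v, f v = 0) -> dotf f (adjop f) = 0.
Proof. by move=> f0; rewrite /dotf big1 // => v _; rewrite f0 mul0r. Qed.

Lemma quad_norm f : dotf f (adjop f) <= dotf (fun v => `|f v|) (adjop (fun v => `|f v|)).
Proof.
apply: ler_sum => v _; rewrite /adjop !mulr_sumr; apply: ler_sum => w _.
by rewrite -normrM ler_norm.
Qed.

(** Taking absolute values keeps the norm and does not decrease the quadratic form, so the maximiser
    may be taken nonnegative; scaling extends its bound to all vectors. *)
Lemma perron_exists : (0 < #|G|)%N ->
  exists mu f, [/\ forall v, 0 <= f v, dotf f f = 1, forall v, adjop f v = mu * f v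
    & forall g, dotf g (adjop g) <= mu * dotf g g].
Proof.
move=> /quad_sphere_max[f f1 fmax].
have nf1 : dotf (fun v => `|f v|) (fun v => `|f v|) = 1.
  by rewrite -f1; apply: eq_bigr => v _; rewrite -normrM ger0_norm // -expr2 sqr_ge0.
have ub g : dotf g (adjop g) <= dotf f (adjop f) * dotf g g.
  have [/dotf_eq0 g0|gN] := eqVneq (dotf g g) 0.
    by rewrite quad_eq0 // /dotf [X in _ * X]big1 ?mulr0 // => v _; rewrite g0 mul0r.
  have gp : 0 < dotf g g by rewrite lt_def gN dotf_ge0.
  pose c := (Num.sqrt (dotf g g))^-1.
  have c2 : c ^+ 2 * dotf g g = 1.
    by rewrite exprVn sqr_sqrtr ?ltW // mulVf.
  have E h h' : dotf (fun v => c * h v) (fun v => c * h' v) = c ^+ 2 * dotf h h'.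
    by rewrite /dotf mulr_sumr; apply: eq_bigr => v _; ring.
  have := fmax (fun v => c * g v); rewrite E => /(_ c2).
  have -> : dotf (fun v => c * g v) (adjop (fun v => c * g v)) = c ^+ 2 * dotf g (adjop g).
    by rewrite -E; apply: eq_dotf => // v; rewrite /adjop mulr_sumr.
  by rewrite -(ler_pM2r gp); apply: le_trans; rewrite mulrAC c2 mul1r.
exists (dotf f (adjop f)), (fun v => `|f v|); split => //.
apply: quad_max_eigen => //; rewrite nf1 mulr1; apply/eqP.
by rewrite eq_le quad_norm andbT fmax.
Qed.

Lemma eigenvalue_adjmxP a :
  eigenvalue (adjmx R G) a <-> exists2 f, exists v, f v != 0 & forall v, adjop f v = a * f v.
Proof.
have E f v : (\row_i f (enum_val i) *m adjmx R G) 0 (enum_rank v) = adjop f v.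
  rewrite mxE /adjop [RHS]big_mkcond (reindex_onto (@enum_val _ G) enum_rank); last first.
    by move=> w _; rewrite enum_rankK.
  apply: eq_big => i; first by rewrite enum_valK eqxx.
  by rewrite !mxE enum_rankK adj_sym => _; case: adj; rewrite /= ?mulr1 ?mulr0.
split.
- move=> /eigenvalueP[x xE x0].
  have xrow : x = \row_i x 0 (enum_rank (enum_val i)).
    by apply/rowP => i; rewrite mxE enum_valK.
  exists (fun v => x 0 (enum_rank v)).
    apply/existsP; apply: contraNT x0; rewrite negb_exists => /forallP x0.
    apply/eqP/rowP => i; rewrite mxE; apply/eqP; have := x0 (enum_val i).
    by rewrite enum_valK negbK.
  by move=> v; rewrite -E -xrow xE mxE.
- move=> [f [v fv] fE]; apply/eigenvalueP; exists (\row_i f (enum_val i)).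
    by apply/rowP => i; rewrite -(enum_valK i) E fE !mxE enum_rankK.
  by apply: contraNneq fv => /rowP/(_ (enum_rank v)); rewrite !mxE enum_rankK => ->.
Qed.

(** The Rayleigh quotient of any eigenvector is its eigenvalue, hence at most the maximum [mu],
    which is itself an eigenvalue; so the supremum is [mu]. *)
Lemma perron : (0 < #|G|)%N ->
  (exists f, [/\ forall v, 0 <= f v, exists v, 0 < f v
    & forall v, adjop f v = spectral_radius R G * f v])
  /\ forall g, dotf g (adjop g) <= spectral_radius R G * dotf g g.
Proof.
move=> /perron_exists[mu [f [f0 f1 fE ub]]].
have fp : exists v, 0 < f v.
  case: (boolP [exists v, 0 < f v]) => [/existsP //|]; rewrite negb_exists => /forallP fn.
  move: f1; rewrite /dotf big1 => [/eqP|v _]; first by rewrite eq_sym oner_eq0.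
  by have := fn v; rewrite -leNgt => fv; rewrite (@le_anti _ _ (f v) 0) ?mul0r // fv f0.
suff -> : spectral_radius R G = mu by split => //; exists f.
have mu_eig : eigenvalue (adjmx R G) mu.
  by apply/eigenvalue_adjmxP; exists f => //; have [v fv] := fp; exists v; rewrite gt_eqF.
have mu_ub : ubound [set a | eigenvalue (adjmx R G) a]%classic mu.
  move=> a /= /eigenvalue_adjmxP[g [v gv] gE].
  have gp : 0 < dotf g g.
    rewrite lt_def dotf_ge0 andbT; apply: contra_neq gv => /dotf_eq0; exact.
  have := ub g; rewrite (eq_dotf (fun=> erefl) gE) dotfZr ler_pM2r //.
apply/eqP; rewrite eq_le ge_sup //=; last by exists mu.
by rewrite ub_le_sup //; exists mu.
Qed.

End Quadratic.

(** * Monotonicity of the spectral radius *)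

Section Embedding.
Context {R : realType}.

(** Transport a Perron vector of [G] to [H]: its entries are nonnegative, so the additional edges of
    [H] can only raise the quadratic form. *)
Lemma spectral_radius_hom (G H : sgraph) (f : G -> H) : (0 < #|G|)%N -> bijective f ->
    (forall x y, adj x y -> adj (f x) (f y)) ->
  spectral_radius R G <= spectral_radius R H.
Proof.
move=> G0 [g fK gK] fhom.
have H0 : (0 < #|H|)%N by case/card_gt0P: G0 => v _; apply/card_gt0P; exists (f v).
have [[x [x0 [v xv] xE]] _] := @perron R G G0.
have [_ ub] := @perron R H H0.
have re (h : H -> R) : \sum_w h w = \sum_v h (f v).
  by apply: reindex; exists g => ? _.
have := ub (x \o g); rewrite /dotf !re /=.
under [X in _ <= _ * X -> _]eq_bigr do rewrite fK.
have xp : 0 < \sum_v x v * x v.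
  rewrite (bigD1 v) //= ltr_wpDr ?mulr_gt0 //; apply: sumr_ge0 => w _; exact: mulr_ge0.
move=> le_x; rewrite -(ler_pM2r xp); apply: le_trans le_x.
rewrite mulr_sumr; apply: ler_sum => w _; rewrite fK mulrCA -xE ler_wpM2l //.
rewrite /adjop [leRHS]big_mkcond re -big_mkcond /= big_mkcond [leRHS]big_mkcond.
apply: ler_sum => u _; rewrite fK; case: ifP => [/fhom ->//|_].
by case: ifP.
Qed.
End Embedding.

(** * Spectral bounds *)

Section Spectral.
Context {R : realType}.

Notation rho G := (spectral_radius R G).
Notation degs G := (deg (@adj G)).

(** The first sum is the row sum of $A^2$ at [x]. In the total degree, [x] contributes its own
    degree and each other non-neighbour at least [k]. *)
Lemma sum_nbr_deg_le (G : sgraph) (k : nat) (x : G) : (forall y, k <= degs G y)%N ->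
  (\sum_(y | adj x y) degs G y + k * (#|G| - 1 - degs G x) + degs G x
   <= \sum_y degs G y)%N.
Proof.
move=> kdeg; rewrite [leqRHS](bigID (adj x)) /= -addnA leq_add2l.
rewrite (bigD1 x) ?adj_irr //= addnC leq_add2l mulnC.
have -> : (#|G| - 1 - degs G x)%N = #|[set y | ~~ adj x y && (y != x)]|.
  rewrite subn1 -(cardsC1 x) -(cardsID [set y | adj x y] [set~ x]).
  have -> : [set~ x] :&: [set y | adj x y] = [set y | adj x y].
    apply/setP => y; rewrite !inE andbC.
    by have [->|] := eqVneq y x; rewrite ?adj_irr ?andbT.
  by rewrite addKn; apply: eq_card => y; rewrite !inE.
rewrite -sum_nat_const; under [leqLHS]eq_bigl do rewrite inE.
exact: leq_sum.
Qed.

Lemma adjop1 (G : sgraph) (v : G) : adjop (fun=> 1 : R) v = (degs G v)%:R.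
Proof. by rewrite /adjop sumr_const /deg cardsE. Qed.

(* A nonnegative eigenvector turns a bound on the row sums of
   [A ^ 2 - (k - 1) A] into a bound on its eigenvalue. *)
Lemma spectral_radius_deg_bound (G : sgraph) (k : nat) : (0 < #|G|)%N ->
    (forall y, k <= degs G y)%N ->
  rho G ^+ 2 <= (\sum_y degs G y)%:R - k%:R * (#|G| - 1)%:R + (k%:R - 1) * rho G.
Proof.
move=> G0 kdeg; have [[f [f0 [v fv] fE]] _] := @perron R G G0.
pose S := \sum_v f v; set mu := rho G in fE *.
have Sp : 0 < S.
  by rewrite /S (bigD1 v) //= ltr_wpDr //; apply: sumr_ge0.
(* [E1] and [E2] pair the eigenvector with the row sums of $A$ and $A^2$, using that $A$ is
   symmetric. *)
have E1 : \sum_v (degs G v)%:R * f v = mu * S.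
  have := adjop_sym (fun=> 1) f; rewrite /dotf.
  under [X in _ = X -> _]eq_bigr do rewrite adjop1.
  by move=> <-; rewrite mulr_sumr; apply: eq_bigr => w _; rewrite fE mul1r.
have E2 : \sum_w (\sum_(y | adj w y) degs G y)%:R * f w = mu ^+ 2 * S.
  rewrite expr2 -mulrA -E1 mulr_sumr; have := adjop_sym (fun w => (degs G w)%:R) f.
  rewrite /dotf => E.
  transitivity (\sum_v adjop (fun w => (degs G w)%:R) v * f v).
    by apply: eq_bigr => w _; rewrite /adjop natr_sum.
  by rewrite -E; apply: eq_bigr => w _; rewrite fE; ring.
rewrite -(ler_pM2r Sp) -E2 mulrDl -mulrA -E1 /S !mulr_sumr -big_split /=.
apply: ler_sum => w _; rewrite mulrA -mulrDl ler_wpM2r //.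
have := sum_nbr_deg_le w kdeg; rewrite -(ler_nat R) !natrD natrM.
rewrite natrB; first lra.
rewrite subn1 -(cardsC1 w). apply: subset_leq_card. apply/subsetP => y.
by rewrite !inE; apply: contraTneq => ->; rewrite adj_irr.
Qed.

Lemma adjop_ge_sum (G : sgraph) (g : G -> R) (A : {set G}) (x : G) :
    (forall y, 0 <= g y) -> (forall y, y \in A -> adj x y) ->
  \sum_(y in A) g y <= adjop g x.
Proof.
move=> g0 Ax; rewrite /adjop [leRHS](bigID (mem A)) /=.
rewrite (eq_bigl (fun y => adj x y && (y \in A))) ?lerDl ?sumr_ge0 // => y.
by case yA: (y \in A); rewrite ?andbF // Ax.
Qed.

(** Rayleigh quotient of the vector equal to 1 on the clique and to a small [eps] on [T]. *)
Lemma spectral_radius_split_ge (G : sgraph) (F T : {set G}) (k t : nat) :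
    [disjoint F & T] -> #|F| = k -> #|T| = t -> (#|T| < #|G|)%N ->
    (forall x y : G, x \notin T -> y \notin T -> x != y -> adj x y) ->
    (forall x y : G, x \in F -> y \in T -> adj x y) ->
  (#|G| - t)%:R - 1 <= rho G
  /\ ((0 < k)%N -> (0 < t)%N -> (#|G| - t)%:R - 1 < rho G).
Proof.
move=> FT Fk Tt TG clq full.
have G0 : (0 < #|G|)%N by apply: leq_ltn_trans TG.
have [_ ub] := @perron R G G0.
pose c := (#|G| - t)%N; rewrite -/c.
have c0 : 0 < c%:R :> R by rewrite ltr0n subn_gt0 -Tt.
have cT : #|~: T| = c by rewrite cardsCs setCK Tt.
(* A vertex of [T] sees [k] ones and the eigenvalue is about [c]. With this value the quadratic form
   exceeds [c - 1] times the squared norm by at least [t * eps * (k + eps)], see [diff]. *)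
pose eps : R := k%:R / c%:R.
have eps0 : 0 <= eps by rewrite divr_ge0.
pose g (x : G) : R := if x \in T then eps else 1.
have g0 x : 0 <= g x by rewrite /g; case: ifP.
have gN : dotf g g = c%:R + t%:R * eps ^+ 2.
  rewrite /dotf (bigID (mem T)) /= addrC; congr (_ + _).
    rewrite (eq_bigr (fun=> 1)) => [|x /negPf xT]; last by rewrite /g xT mulr1.
    by rewrite sumr_const -cT; congr _%:R; apply: eq_card => x; rewrite !inE.
  rewrite (eq_bigr (fun=> eps ^+ 2)) => [|x xT]; last by rewrite /g xT.
  by rewrite sumr_const -Tt mulr_natl.
have sub_le A x := @adjop_ge_sum G g A x g0.
have gC (A : {set G}) : [disjoint A & T] -> \sum_(y in A) g y = #|A|%:R.
  move=> AT; rewrite (eq_bigr (fun=> 1)) ?sumr_const // => y yA.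
  by rewrite /g (disjointFr AT yA).
have degT x : x \in T -> k%:R <= adjop g x.
  move=> xT; rewrite -Fk -(gC F FT); apply: sub_le => y yF.
  by rewrite adj_sym full.
have degC x : x \notin T -> c%:R - 1 + (if x \in F then t%:R * eps else 0) <= adjop g x.
  move=> xT; pose A := (~: T) :\ x.
  have AT : [disjoint A & T].
    by rewrite disjoints_subset; apply/subsetP => y; rewrite !inE => /andP[].
  have Ac : #|A|%:R = c%:R - 1 :> R.
    have := cardsD1 x (~: T); rewrite in_setC xT cT -/A => ->; rewrite natrD /=; lra.
  have Ax y : y \in A -> adj x y.
    by rewrite !inE => /andP[yx yT]; apply: clq; rewrite // eq_sym.
  case: ifPn => xF; last by rewrite addr0 -Ac -(gC A AT); apply: sub_le.
  have -> : t%:R * eps = \sum_(y in T) g y.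
    rewrite (eq_bigr (fun=> eps)) ?sumr_const ?Tt ?mulr_natl // => y yT.
    by rewrite /g yT.
  rewrite -Ac -(gC A AT) [X in X <= _](_ : _ = \sum_(y in A :|: T) g y); last first.
    by rewrite -bigU //; apply: eq_bigl => y; rewrite !inE.
  apply: sub_le => y; by rewrite inE => /orP[/Ax //|]; apply: full.
have gQ : c%:R * (c%:R - 1) + 2 * (t%:R * k%:R * eps) <= dotf g (adjop g).
  rewrite /dotf (bigID (mem T)) /=.
  have : t%:R * k%:R * eps <= \sum_(x in T) g x * adjop g x.
    rewrite -Tt -mulrA mulr_natl -sumr_const; apply: ler_sum => x xT.
    by rewrite {1}/g xT mulrC ler_wpM2l // degT.
  have : c%:R * (c%:R - 1) + t%:R * k%:R * eps <= \sum_(x | x \notin T) g x * adjop g x.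
    apply: (@le_trans _ _ (\sum_(x | x \notin T)
        (c%:R - 1 + (if x \in F then t%:R * eps else 0)))).
      rewrite big_split /= lerD //.
        rewrite sumr_const mulr_natl (@eq_card _ _ (mem (~: T))) ?cT // => x.
        by rewrite in_setC.
      rewrite -big_mkcondr (eq_bigl (mem F)) /=; last first.
        by move=> x; case xF: (x \in F); rewrite ?andbF // (disjointFr FT xF).
      by rewrite sumr_const Fk -mulr_natl; lra.
    by apply: ler_sum => x xT; rewrite {1}/g (negPf xT) mul1r degC.
  lra.
have := le_trans gQ (ub g); rewrite gN => main.
have Np : 0 < c%:R + t%:R * eps ^+ 2 by rewrite ltr_wpDr // mulr_ge0 ?sqr_ge0.
have diff : c%:R * (c%:R - 1) + 2 * (t%:R * k%:R * eps)
    - (c%:R - 1) * (c%:R + t%:R * eps ^+ 2) =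
   t%:R * eps * (k%:R + eps).
  rewrite /eps; field; exact: lt0r_neq0.
split.
  rewrite -(ler_pM2r Np); apply: le_trans main; rewrite -subr_ge0 diff.
  by apply: mulr_ge0; [apply: mulr_ge0|apply: addr_ge0].
move=> k0 t0; rewrite -(ltr_pM2r Np); apply: lt_le_trans main; rewrite -subr_gt0 diff.
have kp : 0 < k%:R :> R by rewrite ltr0n.
apply: mulr_gt0; last by apply: ltr_wpDr.
by apply: mulr_gt0; rewrite ?ltr0n // divr_gt0.
Qed.

(** For disjoint [F] and [T] this is $K_{|F|}\vee(K_{n-|F|-|T|}+|T|K_1)$, placed on a given vertex
    set so that one vector can be tested on several graphs. *)
Definition split_rel (V : finType) (F T : {set V}) : rel V := fun x y =>
  (x != y) && [|| x \in F, y \in F | (x \notin T) && (y \notin T)].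

Lemma split_rel_sym (V : finType) (F T : {set V}) : symmetric (split_rel F T).
Proof.
move=> x y; rewrite /split_rel eq_sym; congr (_ && _).
by rewrite orbCA [(x \notin T) && _]andbC.
Qed.

Lemma split_rel_irr (V : finType) (F T : {set V}) : irreflexive (split_rel F T).
Proof. by move=> x; rewrite /split_rel eqxx. Qed.

Definition split_graph (V : finType) (F T : {set V}) : sgraph :=
  SGraph (@split_rel_sym V F T) (@split_rel_irr V F T).

(* Move from the graph [G] to the graph [split_graph F' T]: delete the edges
   inside [T] and join [T] to [k - #|F|] further vertices of the clique. On a
   Perron vector every such vertex outweighs every vertex of [T], so the
   quadratic form strictly increases. *)
Lemma spectral_radius_split_lt (G : sgraph) (F T : {set G}) (k s : nat) :
    split_at (@adj G) k s F T -> (#|F| < k)%N -> (2 * k + s + 1 <= #|G|)%N ->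
    (#|G| - (k + s))%:R - 1 < rho G ->
  exists F' : {set G}, [/\ [disjoint F' & T], #|F'| = k &
    rho G < rho (split_graph F' T)].
Proof.
move=> [FT Tc clq full none degT] Fk nk rho_big.
have G0 : (0 < #|G|)%N by lia.
have cT : #|~: T| = (#|G| - (k + s))%N by rewrite cardsCs setCK Tc.
pose C := ~: (F :|: T).
have FsubC : F \subset ~: T by rewrite -disjoints_subset.
have Cc : #|C| = (#|~: T| - #|F|)%N.
  by rewrite /C setCU setIC -setDE cardsD (setIidPr FsubC).
(* Strictness leaves a vertex of [C] outside [F2], which is what [mud] needs below. *)
have dC : (k - #|F| < #|C|)%N by rewrite Cc cT; lia.
have [F2 [F2C F2c]] : exists F2 : {set G}, F2 \subset C /\ #|F2| = (k - #|F|)%N.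
  have /card_geqP[S [uS Sc sub]] : (k - #|F| <= #|C|)%N by apply: ltnW.
  exists [set x in S]; rewrite cardsE (card_uniqP uS) Sc; split => //.
  by apply/subsetP => x; rewrite inE => /sub.
have F2P x : x \in F2 -> (x \notin F) * (x \notin T).
  by move=> /(subsetP F2C); rewrite !inE negb_or => /andP[-> ->].
have F2F : [disjoint F & F2].
  by rewrite disjoint_sym disjoints_subset; apply/subsetP => x /F2P[xF _]; rewrite inE.
have F2T : [disjoint F2 & T].
  by rewrite disjoints_subset; apply/subsetP => x /F2P[_ xT]; rewrite inE.
exists (F :|: F2); split.
- by rewrite disjoints_subset subUset -!disjoints_subset FT F2T.
- by rewrite cardsU (disjoint_setI0 F2F) cards0 subn0 F2c subnKC // ltnW.
have [[f [f0 [v0 fv0] fE]] _] := @perron R G G0.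
have [_ ub] := @perron R (split_graph (F :|: F2) T) G0.
set mu := rho G in fE rho_big *; set mu' := rho (split_graph _ _) in ub *.
set SF := \sum_(y in F) f y; pose SC := \sum_(y in ~: T) f y.
pose a := SC / (mu + 1).
have nR : (#|G| - (k + s))%:R = #|C|%:R + #|F|%:R :> R.
  by rewrite -cT Cc natrB; [lra|exact: subset_leq_card].
have mu1 : 0 < mu + 1.
  by move: rho_big; rewrite nR; have := ler0n R #|C|; have := ler0n R #|F|; lra.
(* The vertices of [C] are twins: each is adjacent exactly to the rest of the clique, so the
   eigenvalue equation gives them the common value [a]. *)
have fC x : x \in C -> f x = a.
  rewrite !inE negb_or => /andP[xF xT]; rewrite /a.
  have := fE x; have -> : adjop f x = SC - f x.
    rewrite /SC [in RHS](bigD1 x) ?in_setC //= [f x + _]addrC addrK.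
    apply: eq_bigl => y; rewrite [in RHS]in_setC.
    have [->|yx] := eqVneq y x; first by rewrite adj_irr andbF.
    have [yT|yT] := boolP (y \in T); rewrite /=.
      by rewrite (negPf (none _ _ _ _ _)).
    by rewrite clq // eq_sym.
  move=> E; have -> : SC = (mu + 1) * f x by lra.
  by field; apply: lt0r_neq0.
have SCE : SC = SF + #|C|%:R * a.
  rewrite /SC (bigID (mem F)) /=; congr (_ + _).
    apply: eq_bigl => x; rewrite inE andbC.
    by case xF: (x \in F); rewrite //= (disjointFr FT xF).
  rewrite (eq_bigl (fun x => x \in C)) => [|x]; last by rewrite !inE negb_or andbC.
  by rewrite (eq_bigr _ fC) sumr_const mulr_natl.
have aE : (mu + 1 - #|C|%:R) * a = SF.
  have : (mu + 1) * a = SC by rewrite /a; field; apply: lt0r_neq0.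
  by rewrite SCE; lra.
pose NT t := [set y in T | adj t y].
have NTc t : t \in T -> #|NT t| = (k - #|F|)%N.
  move=> tT; have <- := degT t tT; rewrite /deg -(cardsID T [set y | adj t y]).
  have -> : [set y | adj t y] :\: T = F.
    apply/setP => y; rewrite !inE; have [yF|yF] := boolP (y \in F).
      by rewrite (disjointFr FT yF) adj_sym full.
    have [//|yT] := boolP (y \in T).
    by rewrite adj_sym (negPf (none _ _ _ _ _)).
  by rewrite addnK; apply: eq_card => y; rewrite !inE andbC.
have fT t : t \in T -> adjop f t = SF + \sum_(y in NT t) f y.
  move=> tT; rewrite /adjop (bigID (mem T)) /= addrC; congr (_ + _).
    apply: eq_bigl => y; have [yF|yF] := boolP (y \in F).
      by rewrite (disjointFr FT yF) adj_sym full.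
    have [yT|yT] := boolP (y \in T); first by rewrite andbF.
    by rewrite adj_sym (negPf (none _ _ _ _ _)).
  by apply: eq_bigl => y; rewrite inE andbC.
have kF : k%:R = #|F|%:R + (k - #|F|)%:R :> R by rewrite -natrD subnKC // ltnW.
set d := (k - #|F|)%N in F2c NTc kF.
have d0 : 0 < d%:R :> R by rewrite ltr0n subn_gt0.
have muC : 0 < mu + 1 - #|C|%:R by move: rho_big; rewrite nR; have := ler0n R #|F|; lra.
have mud : mu + 1 - #|C|%:R <= mu - d%:R.
  have : d%:R + 1 <= #|C|%:R :> R by rewrite natr1 ler_nat.
  lra.
have a0 : 0 <= a.
  by rewrite /a divr_ge0 ?(ltW mu1) // sumr_ge0.
(* At a maximum [t1] of [f] on [T], the eigenvalue equation gives [(mu - d) * f t1 <= SF], and [SF]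
   is [(mu + 1 - #|C|) * a] with a factor that is positive and at most [mu - d]. *)
have fTa t : t \in T -> f t <= a.
  move=> tT; have [t1 t1T tmax] := @arg_maxP _ _ _ t (mem T) f tT.
  apply: le_trans (tmax t tT) _.
  have : (mu - d%:R) * f t1 <= (mu + 1 - #|C|%:R) * a.
    rewrite aE mulrBl -fE fT // -(NTc _ t1T) lerBlDr lerD2l mulr_natl -sumr_const.
    by apply: ler_sum => y; rewrite inE => /andP[yT _]; apply: tmax.
  move=> h; rewrite -(ler_pM2l muC); apply: le_trans h.
  by rewrite ler_wpM2r.
pose ST := \sum_(t in T) f t.
(* If [f] vanished on [T], the equation at a vertex of [T] would make it vanish on [F], then [aE] on
   [C], hence everywhere. *)
have ST0 : 0 < ST.
  rewrite lt_def sumr_ge0 // andbT; apply: contraL fv0 => /eqP ST0.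
  have T0 t : t \in T -> f t = 0.
    move: ST0 => /eqP; rewrite psumr_eq0 // => /allP h tT.
    by have := h t (mem_index_enum _); rewrite tT => /eqP.
  have [t tT] : exists t, t \in T.
    by apply/card_gt0P; rewrite Tc addn_gt0 (leq_ltn_trans _ Fk).
  have SF0 : SF = 0.
    have := fE t; rewrite T0 // mulr0 fT // big1 ?addr0 // => y.
    by rewrite inE => /andP[/T0].
  have a00 : a = 0 by move/eqP: aE; rewrite SF0 mulf_eq0 (gt_eqF muC) => /eqP.
  rewrite -leNgt.
  have [v0T|v0T] := boolP (v0 \in T); first by rewrite T0.
  have [v0F|v0F] := boolP (v0 \in F); last first.
    by rewrite fC ?a00 // !inE negb_or v0F.
  move: SF0 => /eqP; rewrite psumr_eq0 // => /allP/(_ v0 (mem_index_enum _)).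
  by rewrite v0F => /eqP ->.
have ap : 0 < a.
  have [t tT tp] : exists2 t, t \in T & 0 < f t.
    apply/exists_inP; apply: contraLR ST0; rewrite negb_exists_in => /forall_inP h.
    by rewrite -leNgt; apply: sumr_le0 => t /h; rewrite leNgt.
  exact: lt_le_trans tp (fTa _ tT).
(* A vertex of [T] trades [d] neighbours in [T], of value at most [a], for the [d] vertices of [F2],
   of value [a]. A vertex of [F2] gains all of [T], and the other vertices lose nothing. *)
have up (v : G) : adjop f v + (if v \in F2 then ST else 0) <=
    @adjop R (split_graph (F :|: F2) T) f v.
  have ge A := @adjop_ge_sum (split_graph (F :|: F2) T) f A v f0.
  have [vT|vT] := boolP (v \in T).
    rewrite (disjointFl F2T vT) addr0 fT //.
    apply: (@le_trans _ _ (\sum_(y in F :|: F2) f y)); last first.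
      apply: ge => y yF; rewrite /adj /= /split_rel yF orbT andbT.
      by apply: contraTneq yF => <-; rewrite inE (disjointFl FT vT) (disjointFl F2T vT).
    have -> : \sum_(y in F :|: F2) f y = SF + \sum_(y in F2) f y.
      by rewrite -bigU //; apply: eq_bigl => y; rewrite !inE.
    rewrite lerD2l; apply: (@le_trans _ _ (\sum_(y in NT v) a)).
      by apply: ler_sum => y; rewrite inE => /andP[/fTa].
    rewrite sumr_const NTc // -F2c -sumr_const.
    by apply: ler_sum => y /(subsetP F2C)/fC ->.
  have nbr y : adj v y -> split_rel (F :|: F2) T v y.
    move=> vy; rewrite /split_rel; apply/andP; split.
      by apply: contraTneq vy => ->; rewrite adj_irr.
    have [yT|yT] := boolP (y \in T); last by rewrite vT !orbT.
    rewrite inE; have [//|vF] := boolP (v \in F).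
    by move: vy; rewrite (negPf (none _ _ _ _ _)).
  have nbrE : adjop f v = \sum_(y in [set y | adj v y]) f y.
    by apply: eq_bigl => y; rewrite inE.
  case: ifPn => vF2; last first.
    by rewrite addr0 nbrE; apply: ge => y; rewrite inE => /nbr.
  have -> : adjop f v + ST = \sum_(y in [set y | adj v y] :|: T) f y.
    rewrite nbrE -bigU; last first.
      rewrite disjoints_subset; apply/subsetP => y; rewrite !inE => vy.
      apply: contraL vy => yT; apply: none => //; exact: (F2P _ vF2).1.
    by apply: eq_bigl => y; rewrite !inE.
  apply: ge => y; rewrite !inE => /orP[/nbr //|yT].
  rewrite /adj /= /split_rel !inE vF2 orbT andbT.
  by apply: contraTneq yT => <-.
have fp : 0 < dotf f f.
  rewrite /dotf (bigD1 v0) //= ltr_wpDr ?mulr_gt0 //.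
  by apply: sumr_ge0 => w _; apply: mulr_ge0.
rewrite -(ltr_pM2r fp); apply: lt_le_trans (ub f).
have -> : mu * dotf f f = dotf f (adjop f).
  by rewrite -dotfZr; apply: eq_dotf => // v; rewrite fE.
apply: (@lt_le_trans _ _ (dotf f (adjop f) + d%:R * (a * ST))).
  by rewrite ltrDl; apply: mulr_gt0 => //; apply: mulr_gt0.
have -> : d%:R * (a * ST) = \sum_v f v * (if v \in F2 then ST else 0).
  rewrite mulr_natl -F2c -sumr_const big_mkcond; apply: eq_bigr => v _.
  by case: ifP => [/(subsetP F2C)/fC ->|]; rewrite ?mulr0.
rewrite /dotf -big_split; apply: ler_sum => v _ /=.
by rewrite -mulrDr ler_wpM2l.
Qed.

End Spectral.

(** * The extremal graphs *)

(** Match the fibres of the two colourings by position in their enumerations; [w0] is only the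
    default value of [nth]. *)
Lemma fiber_bij (C : eqType) (V W : finType) (c : V -> C) (c' : W -> C) (w0 : W) :
    #|V| = #|W| -> (forall i, #|[set x | c x == i]| = #|[set y | c' y == i]|) ->
  exists2 f : V -> W, bijective f & forall x, c' (f x) = c x.
Proof.
move=> VW cc; pose s i := enum [set x | c x == i]; pose s' i := enum [set y | c' y == i].
have ss i : size (s i) = size (s' i) by rewrite -!cardE cc.
have xs x : x \in s (c x) by rewrite mem_enum inE.
pose f x := nth w0 (s' (c x)) (index x (s (c x))).
have fs x : f x \in s' (c x) by rewrite mem_nth // -ss index_mem.
have cf x : c' (f x) = c x by apply/eqP; have := fs x; rewrite mem_enum inE.
exists f => //; apply: inj_card_bij; last by rewrite VW.
move=> x y fxy; have cxy : c x = c y by rewrite -!cf fxy.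
have ys : y \in s (c x) by rewrite cxy.
move/eqP: fxy; rewrite /f -cxy nth_uniq -?ss ?index_mem ?enum_uniq //.
by move/eqP/index_inj; apply.
Qed.

(** Colour [F], [T] and the rest by 0, 1, 2: for distinct vertices [split_rel] depends on the
    colours only, so any colour-preserving bijection is an isomorphism. *)
Lemma split_iso (G H : sgraph) (F T : {set G}) (F' T' : {set H}) :
    (0 < #|G|)%N -> #|G| = #|H| -> [disjoint F & T] -> [disjoint F' & T'] ->
    #|F| = #|F'| -> #|T| = #|T'| ->
    @adj G =2 split_rel F T -> @adj H =2 split_rel F' T' ->
  isomorphic G H.
Proof.
move=> G0 GH FT FT' FF TT GE HE.
pose col (V : finType) (A B : {set V}) x : nat :=
  if x \in A then 0 else if x \in B then 1 else 2.
have [w0 _] : exists w : H, w \in H by apply/card_gt0P; rewrite -GH.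
have colF (V : finType) (A B : {set V}) x : (x \in A) = (col V A B x == 0%N).
  by rewrite /col; case: (x \in A); case: (x \in B).
have colT (V : finType) (A B : {set V}) x : [disjoint A & B] ->
    (x \in B) = (col V A B x == 1%N).
  move=> AB; rewrite /col; case: ifP => [xA|_]; first by rewrite (disjointFr AB xA).
  by case: ifP.
have fib (V : finType) (A B : {set V}) i : [disjoint A & B] ->
  #|[set x | col V A B x == i]| =
    match i with
    | 0%N => #|A| | 1%N => #|B| | 2%N => (#|V| - (#|A| + #|B|))%N | _ => 0%N
    end.
  move=> AB; case: i => [|[|[|i]]].
  - by apply: eq_card => x; rewrite inE -colF.
  - by apply: eq_card => x; rewrite inE -colT.
  - rewrite -(setCK [set x | _]) cardsCs setCK; congr (_ - _)%N.
    have -> : (#|A| + #|B|)%N = #|A :|: B|.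
      by rewrite cardsU (disjoint_setI0 AB) cards0 subn0.
    apply: eq_card => x; by rewrite !inE /col; case: (x \in A); case: (x \in B).
  - apply/eqP; rewrite cards_eq0; apply/eqP/setP => x; rewrite !inE /col.
    by case: (x \in A); case: (x \in B).
have [|f fb fc] := @fiber_bij nat G H (col G F T) (col H F' T') w0 GH.
  by move=> i; rewrite !fib // FF TT GH.
exists f => // x y; rewrite HE GE /split_rel (bij_eq fb).
by rewrite !(colF _ F T) !(colF _ F' T') !(colT _ F T) // !(colT _ F' T') // !fc.
Qed.

(* [split_family k m t] is $K_k \vee (K_m + t K_1)$. *)
Definition split_family (k m t : nat) : sgraph :=
  join (complete k) (union (complete m) (copies t (complete 1))).

Definition family_hub k m t : {set split_family k m t} :=
  [set x | if x is inl _ then true else false].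

Definition family_indep k m t : {set split_family k m t} :=
  [set x | if x is inr (inr _) then true else false].

Lemma family_disj k m t : [disjoint family_hub k m t & family_indep k m t].
Proof. by rewrite disjoints_subset; apply/subsetP => -[?|[?|?]]; rewrite !inE. Qed.

Lemma family_hub_card k m t : #|family_hub k m t| = k.
Proof.
have inj : injective (fun x : 'I_k => inl x : split_family k m t).
  by move=> x y [].
rewrite -[RHS]card_ord -cardsT -(card_imset _ inj); apply: eq_card => -[x|x].
  by rewrite !inE imset_f ?inE.
rewrite !inE.
by apply/esym/negbTE/imsetP => -[].
Qed.

Lemma family_indep_card k m t : #|family_indep k m t| = t.
Proof.
have inj : injective (fun x : 'I_t * 'I_1 => inr (inr x) : split_family k m t).
  by move=> x y [].
transitivity #|{: 'I_t * 'I_1}|; last by rewrite card_prod !card_ord muln1.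
rewrite -cardsT -(card_imset _ inj); apply: eq_card => -[x|[x|x]]; rewrite !inE.
- by apply/esym/negbTE/imsetP => -[].
- by apply/esym/negbTE/imsetP => -[].
- by rewrite imset_f ?inE.
Qed.

Lemma family_card k m t : #|split_family k m t| = (k + m + t)%N.
Proof. by rewrite !card_sum card_prod !card_ord muln1 addnA. Qed.

Lemma family_adj k m t :
  @adj (split_family k m t) =2 split_rel (family_hub k m t) (family_indep k m t).
Proof.
move=> [x|[x|[x i]]] [y|[y|[y j]]]; rewrite /split_rel !inE //= ?andbT //.
by rewrite /copies_adj /= /complete_adj !ord1 eqxx !andbF.
Qed.

(** Serves the case [k = 0], in which [F] is empty and [dominated_rho_eq] has no dominating vertex
    to use. *)
Lemma subgraph_deg_sum_eq (V : finType) (e e' : rel V) : subrel e e' ->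
  (\sum_x deg e' x <= \sum_x deg e x)%N -> e =2 e'.
Proof.
move=> sub le x.
have dle z : (deg e z <= deg e' z)%N.
  by apply: subset_leq_card; apply/subsetP => y; rewrite !inE => /sub.
have dE : (deg e' x <= deg e x)%N.
  move: le; rewrite (bigD1 x) //= [leqRHS](bigD1 x) //=.
  have : (\sum_(i | i != x) deg e i <= \sum_(i | i != x) deg e' i)%N by apply: leq_sum.
  lia.
have /eqP/setP E : [set y | e x y] == [set y | e' x y].
  by rewrite eqEcard dE andbT; apply/subsetP => y; rewrite !inE => /sub.
by move=> y; have := E y; rewrite !inE.
Qed.

(** * From the closure to the extremal graph *)

Section Main.
Context {R : realType}.
Notation rho G := (spectral_radius R G).

(** A Perron vector of [G] is also optimal for the larger graph, hence an eigenvector of it. The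
    dominating vertex [u] makes it positive everywhere, so an edge missing in [G] would make the
    quadratic form strictly smaller. *)
Lemma dominated_rho_eq (G : sgraph) (e : rel G) (es : symmetric e)
    (ei : irreflexive e) (u : G) :
    (forall x, x != u -> e u x) -> subrel (@adj G) e ->
    rho (SGraph es ei) <= rho G -> @adj G =2 e.
Proof.
move=> dom sub le.
have G0 : (0 < #|G|)%N by apply/card_gt0P; exists u.
have [[f [f0 [v fv] fE]] _] := @perron R G G0.
pose H := SGraph es ei.
have [_ ub] := @perron R H G0.
have N0 : 0 <= dotf f f by apply: dotf_ge0.
have QG : dotf f (adjop f) = rho G * dotf f f.
  by rewrite -dotfZr; apply: eq_dotf.
have lev x : adjop f x <= @adjop R H f x.
  rewrite /adjop [leRHS](bigID (adj x)) /= (eq_bigl (fun y => e x y && adj x y)).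
    by rewrite lerDl sumr_ge0.
  by move=> y; case exy: (adj x y); rewrite ?andbF // (sub _ _ exy).
have QGH : dotf f (adjop f) <= dotf f (@adjop R H f).
  by apply: ler_sum => x _; rewrite ler_wpM2l.
have QH : dotf f (@adjop R H f) = rho H * dotf f f.
  apply/eqP; rewrite eq_le ub /=; apply: le_trans QGH; rewrite QG.
  by rewrite ler_wpM2r.
have Hf := @quad_max_eigen R H f _ QH ub.
(* A zero of a nonnegative eigenvector spreads to all neighbours: from [x] to [u], and from [u] to
   every vertex. *)
have fp x : 0 < f x.
  have fu0 : f u != 0.
    apply: contraL fv => /eqP fu; rewrite -leNgt.
    have [-> |vu] := eqVneq v u; first by rewrite fu.
    have := Hf u; rewrite fu mulr0 /adjop => /eqP; rewrite psumr_eq0 //.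
    by move=> /allP/(_ v (mem_index_enum _)) /implyP/(_ (dom _ vu))/eqP->.
  rewrite lt_def f0 andbT; apply: contraNneq fu0 => fx.
  have [<-|xu] := eqVneq x u; first by rewrite fx.
  have := Hf x; rewrite fx mulr0 /adjop => /eqP; rewrite psumr_eq0 //.
  move=> /allP/(_ u (mem_index_enum _)) /implyP; apply.
  by rewrite /= es; apply: dom.
move=> x y; apply/idP/idP => [/sub//|exy]; apply/negPn/negP => nxy.
have : dotf f (adjop f) < dotf f (@adjop R H f).
  rewrite /dotf (bigD1 x) //= [ltRHS](bigD1 x) //=; apply: ltr_leD; last first.
    by apply: ler_sum => z _; rewrite ler_wpM2l.
  rewrite ltr_pM2l // /adjop [ltRHS](bigID (adj x)) /=.
  rewrite (eq_bigl (fun y => e x y && adj x y)); last first.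
    by move=> z; case exz: (adj x z); rewrite ?andbF // (sub _ _ exz).
  rewrite ltrDl (bigD1 y) /= ?exy ?nxy // ltr_wpDr //.
  by apply: sumr_ge0.
by rewrite QG QH ltNge ler_wpM2r.
Qed.

(** The function $x^2-(k-1)x$ increases beyond [m], as the factor $\rho + m - k + 1$ is positive;
    the bound on the degree sum is its value at [m] plus $k(n-1)$. *)
Lemma deg_sum_ge (G : sgraph) (k s m : nat) : (0 < #|G|)%N ->
    (forall x, k <= deg (@adj G) x)%N -> #|G| = (m + k + s + 1)%N -> (k <= m)%N ->
    m%:R <= rho G ->
  (m * m + m + k * k + k * s <= \sum_x deg (@adj G) x)%N
  /\ (m%:R < rho G -> (m * m + m + k * k + k * s < \sum_x deg (@adj G) x)%N).
Proof.
move=> G0 kdeg nE km le; have := @spectral_radius_deg_bound R G k G0 kdeg.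
rewrite nE addn1 subn1 /= !natrD => bound.
have kmR : k%:R <= m%:R :> R by rewrite ler_nat.
have m0 : 0 <= m%:R :> R by [].
split=> [|lt]; first rewrite -(ler_nat R) !natrD !natrM.
  have : 0 <= (rho G - m%:R) * (rho G + m%:R - k%:R + 1) by apply: mulr_ge0; lra.
  by move: bound; lra.
rewrite -(ltr_nat R) !natrD !natrM.
have : 0 < (rho G - m%:R) * (rho G + m%:R - k%:R + 1) by apply: mulr_gt0; lra.
by move: bound; lra.
Qed.

(** Both halves of the theorem at once: [P] is traceability with [s = 1] or Hamiltonicity with
    [s = 0]. The number [m + 1] is the order of the clique formed by the vertices outside the
    independent part of [N]. *)
Lemma main_split (G : sgraph) (k s m : nat) (P : rel G -> Prop) :
    (0 < k + s)%N -> #|G| = (m + k + s + 1)%N ->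
    (6 * k + 5 * s + 5 <= #|G|)%N -> (k * k + 4 * k + 2 + k * s + 2 * s <= 2 * m)%N ->
    (forall x, k <= deg (@adj G) x)%N ->
    (forall e u v, symmetric e -> irreflexive e -> u != v ->
      (#|G| <= deg e u + deg e v + s)%N -> P (add_edge e u v) -> P e) ->
    (forall e, symmetric e -> irreflexive e -> (forall x y, x != y -> e x y) -> P e) ->
    rho (split_family k (m + 1 - k) (k + s)) <= rho G ->
    ~ isomorphic G (split_family k (m + 1 - k) (k + s)) ->
  P (@adj G).
Proof.
set N := split_family _ _ _.
move=> ks nE n_big m_big kdeg ore compl NG niso; apply: contrapT => nP.
have G0 : (0 < #|G|)%N by rewrite nE addn1.
have km : (k <= m)%N by lia.
have NGc : #|N| = #|G| by rewrite family_card nE; lia.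
have [e [es ei sub nPe closed]] := closure_exists ore (@adj_sym G) (@adj_irr G) nP.
pose H := SGraph es ei.
have GH : rho G <= rho H by apply: (@spectral_radius_hom R G H id) => //; exists id.
have mE : (#|G| - (k + s))%:R - 1 = m%:R :> R.
  have -> : (#|G| - (k + s) = m + 1)%N by lia.
  by rewrite natrD; lra.
have [Nge Ngt] : m%:R <= rho N /\ ((0 < k)%N -> m%:R < rho N).
  have [] := @spectral_radius_split_ge R N _ _ k (k + s) (family_disj _ _ _)
    (family_hub_card _ _ _) (family_indep_card _ _ _).
  - by rewrite family_indep_card NGc; lia.
  - by move=> x y xT yT xy; rewrite family_adj /split_rel xy xT yT !orbT.
  - move=> x y xF yT; rewrite family_adj /split_rel xF andbT.
    by apply: contraTneq yT => <-; rewrite (disjointFr (family_disj _ _ _) xF).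
  by rewrite NGc mE => Nge Ngt; split => // k0; apply: Ngt.
have kdegH x : (k <= deg e x)%N.
  apply: leq_trans (kdeg x) _; apply: subset_leq_card.
  by apply/subsetP => y; rewrite !inE => /sub.
have HN : rho N <= rho H := le_trans NG GH.
have [Dge Dgt] := @deg_sum_ge H k s m G0 kdegH nE km (le_trans Nge HN).
(* For [k > 0] the strict bound [Dgt] reduces this, after cancellation, to exactly the quadratic
   hypothesis on [m]. For [k = 0] the weak bound [Dge] suffices. *)
have dense : (2 * k.+1 * (k.+1 + s) + (#|G| - k - s - 1) * (#|G| - k - s - 2) <
    \sum_x deg e x)%N.
  have -> : (#|G| - k - s - 1 = m)%N by lia.
  have -> : (#|G| - k - s - 2 = m - 1)%N by lia.
  have [k0|k0] := posnP k.
    move: Dge n_big; rewrite nE k0; case: (m) => [|m']; first by lia.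
    rewrite subn1 /=; lia.
  have := Dgt (lt_le_trans (Ngt k0) HN); move: n_big m_big.
  rewrite nE; case: (m) => [|m']; first by lia.
  rewrite subn1 /=; lia.
(* The closure is not complete, because complete graphs satisfy [P]. *)
have [|F [T split]] := closed_dense_split es ei n_big kdegH closed dense.
  apply/not_existsP => nex; apply: nPe; apply: compl => // x y xy.
  apply/negPn/negP => exy; apply: (nex x); by exists y.
have [FT Tc clq full none degT] := split.
have [t tT] : exists t, t \in T by apply/card_gt0P; rewrite Tc.
have Fsub t' : t' \in T -> F \subset [set y | e t' y].
  by move=> t'T; apply/subsetP => y yF; rewrite inE es full.
have Fk : (#|F| <= k)%N by rewrite -(degT t tT); apply: subset_leq_card; apply: Fsub.
have iso_N (K : sgraph) (F' T' : {set K}) :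
    [disjoint F' & T'] -> #|F'| = k -> #|T'| = (k + s)%N ->
    #|K| = #|G| -> @adj K =2 split_rel F' T' -> isomorphic K N.
  move=> F'T' F'k T'c KG Ka; apply: (split_iso _ _ F'T' (family_disj _ _ _)) => //.
  - by rewrite KG.
  - by rewrite KG NGc.
  - by rewrite family_hub_card.
  - by rewrite family_indep_card.
  - exact: family_adj.
(* If [#|F| < k], then [k > 0], so the strict bound on [rho N] is available, and moving edges gives
   a copy of [N] whose spectral radius exceeds that of [H], against [HN]. *)
move: Fk; rewrite leq_eqVlt => /orP[/eqP Fk|Fk]; last first.
  have [||F' [F'T F'k lt]] := @spectral_radius_split_lt R H F T k s split Fk.
  - by rewrite /= nE; lia.
  - rewrite /= mE; apply: lt_le_trans HN; apply: Ngt; exact: leq_ltn_trans Fk.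
  have [f fb fa] := iso_N (split_graph F' T) F' T F'T F'k Tc erefl (fun _ _ => erefl).
  have := @spectral_radius_hom R (split_graph F' T) N f G0 fb.
  move=> /(_ (fun x y xy => etrans (fa x y) xy)) le.
  by have := lt_le_trans lt (le_trans le (le_trans NG GH)); rewrite ltxx.
(* Now [F] exhausts the [k] neighbours of each vertex of [T], so [T] is independent and [H] is a
   copy of [N]. *)
have nbrT t' : t' \in T -> [set y | e t' y] = F.
  move=> t'T; apply/esym/eqP; rewrite eqEcard Fsub //= Fk.
  by have := degT t' t'T; rewrite /deg => ->.
have He : @adj H =2 split_rel F T.
  move=> x y; rewrite /= /split_rel; have [->|xy] := eqVneq x y; first by rewrite ei.
  have [xT|xT] := boolP (x \in T).
    rewrite (disjointFl FT xT) /= orbF.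
    by have /setP/(_ y) := nbrT x xT; rewrite inE.
  have [yT|yT] := boolP (y \in T).
    rewrite (disjointFl FT yT) /= orbF es.
    by have /setP/(_ x) := nbrT y yT; rewrite inE.
  by rewrite clq //= !orbT.
suff Ge : @adj G =2 e.
  apply: niso; apply: (iso_N G F T) => // x y; rewrite Ge; exact: He.
have HisoN : isomorphic H N by apply: (iso_N H F T).
(* For [k = 0] the vertices of [T] are isolated in [H], so its degree sum is at most [m * (m + 1)],
   which is already the lower bound for [G]. *)
have [k0|k0] := posnP k.
  apply: subgraph_deg_sum_eq => //.
  have [Gge _] := @deg_sum_ge G k s m G0 kdeg nE km (le_trans Nge NG).
  have := @sum_deg_le G e es ei T 0 _.
  rewrite Tc k0 muln0 mul0n add0n add0n => Hle.
  apply: leq_trans (Hle _) (leq_trans _ Gge) => [x xT|].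
    by rewrite degT // k0.
  by rewrite nE k0; lia.
(* For [k > 0] any vertex of [F] dominates [H]. *)
have [u uF] : exists u, u \in F by apply/card_gt0P; rewrite Fk.
have HG : rho H <= rho G.
  have [f fb fa] := HisoN; apply: le_trans NG.
  by apply: (@spectral_radius_hom R H N f) => // x y xy; rewrite fa.
apply: (dominated_rho_eq _ sub HG (u := u)) => x xu.
have [xT|xT] := boolP (x \in T); first exact: full.
by apply: clq => //; [rewrite (disjointFr FT uF)|rewrite eq_sym].
Qed.

End Main.

(** * Complete graphs and the two instances *)

Lemma complete_path (V : eqType) (e : rel V) x p : (forall x y, x != y -> e x y) ->
  uniq (x :: p) -> path e x p.
Proof.
move=> full; elim: p x => //= y p IH x /andP[xyp yp].
by rewrite IH // andbT full //; move: xyp; rewrite inE negb_or => /andP[].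
Qed.

Lemma complete_trace (V : finType) (e : rel V) : (0 < #|V|)%N ->
  (forall x y, x != y -> e x y) -> trace_rel e.
Proof.
rewrite cardE => V0 full; have := enum_uniq V; have := mem_enum V.
case: (enum V) V0 => [//|x p] _ mE uE; exists x, p; split => //.
exact: complete_path.
Qed.

Lemma complete_ham (V : finType) (e : rel V) : (3 <= #|V|)%N ->
  (forall x y, x != y -> e x y) -> ham_rel e.
Proof.
rewrite cardE => V3 full; have := enum_uniq V; have := mem_enum V.
case: (enum V) V3 => [//|x [//|y p]] V3 mE uE; exists [:: x, y & p]; split => //.
apply/andP; split => //; rewrite /cycle rcons_path complete_path //=.
apply: full; apply: contraTneq uE => {1}<- /=.
by rewrite mem_last.
Qed.

Lemma min_degree_le (G : sgraph) (x : G) : (min_degree G <= deg (@adj G) x)%N.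
Proof.
rewrite /min_degree; elim: (index_enum G) (mem_index_enum x) => // y r IH.
rewrite inE big_cons => /orP[/eqP ->|/IH h]; first exact: geq_minl.
exact: leq_trans (geq_minr _ _) h.
Qed.

Theorem theorem1p5 (R : realType) (k n : nat) (G : sgraph) (hG : #|G| = n) :
  ((0 <= k <= min_degree G)%N ->
   spectral_radius R (graphNu n k) <= spectral_radius R G ->
   Num.max (6 * k + 10)%N%:R ((k ^ 2 + 7 * k + 8)%N%:R / 2) <= n%:R :> R ->
   ~ isomorphic G (graphNu n k) -> traceable G)
  /\
  ((1 <= k <= min_degree G)%N ->
   spectral_radius R (graphN n k) <= spectral_radius R G ->
   Num.max (6 * k + 5)%N%:R ((k ^ 2 + 6 * k + 4)%N%:R / 2) <= n%:R :> R ->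
   ~ isomorphic G (graphN n k) -> hamiltonian G).
Proof.
split=> /andP[k_ge k_le] rho_ge; rewrite ge_max ler_nat ler_pdivrMr // -natrM ler_nat;
  move=> /andP[n_ge n_ge2] niso.
(* Here [s = 1] and [m = n - k - 2], so $k^2+7k+8\le 2n$ becomes the quadratic hypothesis on [m]. *)
- have E : graphNu n k = split_family k (n - k - 2 + 1 - k) (k + 1).
    have nE : (n - 2 * k - 1 = n - k - 2 + 1 - k)%N by clear -n_ge; lia.
    by rewrite (addn1 k) /graphNu nE.
  rewrite E in rho_ge niso.
  apply: (main_split (P := @trace_rel G) (s := 1) _ _ _ _ _ _ _ rho_ge niso); try lia.
  + by move=> x; apply: leq_trans k_le (min_degree_le x).
  + move=> e u v es ei uv big; apply: ore_trace => //.
    by move: big; rewrite addn1 => ->; rewrite andbT; lia.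
  + by move=> e _ _; apply: complete_trace; lia.
(* Here [s = 0] and [m = n - k - 1], so $k^2+6k+4\le 2n$ plays the same part. *)
- have E : graphN n k = split_family k (n - k - 1 + 1 - k) (k + 0).
    have nE : (n - 2 * k = n - k - 1 + 1 - k)%N by clear -n_ge; lia.
    by rewrite (addn0 k) /graphN nE.
  rewrite E in rho_ge niso.
  apply: (main_split (P := @ham_rel G) (s := 0) _ _ _ _ _ _ _ rho_ge niso); try lia.
  + by move=> x; apply: leq_trans k_le (min_degree_le x).
  + move=> e u v es ei uv big; apply: ore_ham => //.
    by move: big; rewrite addn0 => ->; rewrite andbT; lia.
  + by move=> e _ _; apply: complete_ham; lia.
Qed.
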